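(* Let $d\ge2$. The set of alternatives $X\equiv\mathbb{R}_{++}^d$, endowed with the Euclidean topology, is locally compact, separable and completely metrizable. Let $\gg$ be the relation on $\mathbb{R}_{++}^d$ given by $x\gg y$ iff $x_i>y_i$ for all $i=1,\dots,d$. Then the class $\mathcal{P}$ of all preferences on $X$ that are Grodal-transitive and strictly monotone with respect to $\gg$ is a closed set (in the closed convergence topology) of locally strict preferences.
   Context: $\mathbb{R}_{++}=(0,\infty)$. A preference on $X$ is a complete binary relation on $X$ that is closed as a subset of $X\times X$; transitivity is not required. $x\succ y$ means $x\succeq y$ and not $y\succeq x$. $\succeq$ is locally strict if for all $x\succeq y$ and every neighborhood $V$ of $(x,y)$ in $X\times X$ there is $(x',y')\in V$ with $x'\succ y'$. $\succeq$ is Grodal-transitive if for all $x,y,z,w\in X$, $x\succeq y\succ z\succeq w$ implies $x\succeq w$. $\succeq$ is strictly monotone with respect to a relation $\rhd$ if $x\rhd y$ implies $x\succ y$. Closed convergence: $\succeq_n\to\succeq^*$ means (1) for all $x^*\succeq^* y^*$ there are $(x_n,y_n)\to(x^*,y^* )$ with $x_n\succeq_n y_n$ for all $n$; and (2) for every subsequence $\{\succeq_{n_k}\}_k$ and every limit $(x^*,y^* )$ of pairs with $x_{n_k}\succeq_{n_k}y_{n_k}$ for all $k$, $x^*\succeq^*y^*$. For locally compact, separable, completely metrizable $X$ this is convergence in the metrizable closed convergence topology on continuous binary relations (closed subsets of $X\times X$). *)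

(* Defs.v *)
From HB Require Import structures.
From mathcomp Require Import all_boot all_order all_algebra.
From mathcomp Require Import all_classical all_reals all_analysis.
Set Implicit Arguments.
Unset Strict Implicit.
Unset Printing Implicit Defensive.

Import Order.TTheory GRing.Theory Num.Theory.
Import numFieldNormedType.Exports.

Local Open Scope classical_set_scope.
Local Open Scope ring_scope.

(* A binary relation on X is a subset of X * X; A (x, y) reads "x is weakly
   preferred to y". *)
Section relations.
Context {X : topologicalType}.
Implicit Types A : set (X * X).

Definition complete_rel A : Prop := forall x y, A (x, y) \/ A (y, x).

Definition preference A : Prop := complete_rel A /\ closed A.

Definition strict A (x y : X) : Prop := A (x, y) /\ ~ A (y, x).

Definition locally_strict A : Prop :=
  forall x y, A (x, y) -> forall V : set (X * X), nbhs (x, y) V ->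
    exists x' y', V (x', y') /\ strict A x' y'.

Definition Grodal_transitive A : Prop :=
  forall x y z w, A (x, y) -> strict A y z -> A (z, w) -> A (x, w).

Definition strictly_monotone (D : X -> X -> Prop) A : Prop :=
  forall x y, D x y -> strict A x y.

(* Subsequences are given by strictly increasing reindexings k. *)
Definition closed_convergence (u : nat -> set (X * X)) A : Prop :=
  (forall x y, A (x, y) ->
    exists v : nat -> X * X,
      (v @ \oo --> (x, y)) /\ forall n, u n (v n)) /\
  (forall k : nat -> nat, {homo k : m n / (m < n)%N} ->
    forall (v : nat -> X * X) (x y : X),
      (forall j, u (k j) (v j)) -> (v @ \oo --> (x, y)) -> A (x, y)).

End relations.

Record continuous_rel (X : topologicalType) := ContinuousRel {
  graph :> set (X * X);
  graph_closed : closed graph }.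

(* The closed convergence topology on the continuous (i.e. closed) binary
   relations.  A set is open when every sequence converging, in the sense of
   closed_convergence, to one of its points is eventually in it; equivalently
   (closed_continuous_relP), a set is closed when it is stable under limits of
   such sequences.  When X is locally compact, separable and completely
   metrizable, closed_convergence is the sequential convergence of a metrizable
   topology (up to initial terms of a sequence, which matter only for the empty
   relation), and a metrizable topology is determined by its convergent
   sequences, so that this is that topology. *)
Section closed_convergence_topology.
Context {X : topologicalType}.

Definition cc_open (O : set (continuous_rel X)) : Prop :=
  forall (u : nat -> continuous_rel X) (A : continuous_rel X),
    closed_convergence u A -> O A -> \forall n \near \oo, O (u n).

Lemma cc_openT : cc_open setT.
Proof. by move=> u A _ _; exact: nearW. Qed.

Lemma cc_openI : setI_closed cc_open.
Proof.
move=> O1 O2 h1 h2 u A uA [A1 A2].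
exact: filterI (h1 u A uA A1) (h2 u A uA A2).
Qed.

Lemma cc_open_bigU (I : Type) (f : I -> set (continuous_rel X)) :
  (forall i, cc_open (f i)) -> cc_open (\bigcup_i f i).
Proof.
move=> h u A uA [i _ fiA]; apply: filterS (h i u A uA fiA) => n fiu.
by exists i.
Qed.

HB.instance Definition _ := gen_eqMixin (continuous_rel X).
HB.instance Definition _ := gen_choiceMixin (continuous_rel X).
HB.instance Definition _ :=
  isOpenTopological.Build (continuous_rel X) cc_openT cc_openI cc_open_bigU.

Lemma cc_openE : (open : set (set (continuous_rel X))) = cc_open.
Proof. by []. Qed.

Lemma closed_convergence_subseq (u : nat -> continuous_rel X)
    (A : continuous_rel X) (k : nat -> nat) : {homo k : m n / (m < n)%N} ->
  closed_convergence u A -> closed_convergence (u \o k) A.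
Proof.
move=> kh [u1 u2]; split.
  move=> x y /u1[v [vxy uv]]; exists (v \o k); split; last by move=> n; exact: uv.
  apply: cvg_comp vxy => P [N _ NP]; exists N => // n /= Nn; apply: NP => /=.
  apply: leq_trans Nn _; elim: n => // n ih.
  by apply: leq_ltn_trans ih _; exact: kh.
move=> k' k'h v x y uv vxy; apply: (u2 (k \o k')) vxy => //.
by move=> m n mn; apply/kh/k'h.
Qed.

Lemma closed_continuous_relP (C : set (continuous_rel X)) :
  closed C <->
  forall (u : nat -> continuous_rel X) (A : continuous_rel X),
    closed_convergence u A -> (forall n, C (u n)) -> C A.
Proof.
rewrite -openC cc_openE; split => [oC u A uA Cu|h u A uA CA].
  apply: contrapT => CA; have [N _ NC] := oC u A uA CA.
  by apply: (NC N) => /=.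
apply: contrapT => uC.
have {uC} freq N : exists n, (N < n)%N && `[< C (u n) >].
  apply: contrapT => none; apply: uC; exists N.+1 => // n /= Nn Cn.
  by apply: none; exists n; rewrite Nn; apply/asboolP.
pose nxt N := xchoose (freq N).
pose k n := iter n nxt (nxt 0%N).
have kC n : C (u (k n)).
  have nxtC N : C (u (nxt N)).
    by apply/asboolP; have /andP[] := xchooseP (freq N).
  by case: n => [|n]; exact: nxtC.
have kh : {homo k : m n / (m < n)%N}.
  apply: homo_ltn; first exact: ltn_trans.
  by move=> n; have /andP[] := xchooseP (freq (k n)).
exact/CA/(h _ _ (closed_convergence_subseq kh uA)).
Qed.

End closed_convergence_topology.

Definition separable (X : topologicalType) : Prop :=
  exists2 S : set X, countable S & dense S.

Definition completely_metrizable (R : realType) (X : topologicalType) : Prop :=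
  exists d : X -> X -> R,
    [/\ forall x y, d x y = 0 <-> x = y,
        forall x y, d x y = d y x,
        forall x y z, d x z <= d x y + d y z,
        forall (x : X) (V : set X), nbhs x V <->
          exists2 e : R, 0 < e & [set y | d x y < e] `<=` V
      & forall u : nat -> X,
          (forall e : R, 0 < e ->
            exists N : nat, forall m n : nat,
              (N <= m)%N -> (N <= n)%N -> d (u m) (u n) < e) ->
          exists x : X, u @ \oo --> x].

Definition positive_vectors (R : realType) (d : nat) : set 'rV[R]_d :=
  [set x | forall i, 0 < x ord0 i].
Arguments positive_vectors : clear implicits.

(* The topology on the type positive_vectors is the one induced by the topology
   of 'rV[R]_d, which is the topology of uniform convergence of the coordinates,
   i.e. the Euclidean one. *)
Notation posR R d := (set_type (positive_vectors R d)).

Definition all_gt (R : realType) (d : nat) (x y : posR R d) : Prop :=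
  forall i, \val y ord0 i < \val x ord0 i.

Definition Grodal_monotone_preferences (R : realType) (d : nat) :
    set (continuous_rel (posR R d)) :=
  [set A | [/\ preference A, Grodal_transitive A
             & strictly_monotone (@all_gt R d) A]].
Arguments Grodal_monotone_preferences : clear implicits.

(* Main.v *)
(* Taking logarithms coordinatewise is a homeomorphism of the positive
   orthant onto the space of row vectors, which transports the three
   topological properties.

   A limit inherits Grodal transitivity because strict preference is open:
   if z is not weakly preferred to y in the limit and z_n -> z, y_n -> y, then
   eventually z_n is not weakly preferred to y_n.  It inherits strict
   monotonicity because >> is an open relation.

   For local strictness, let x be weakly preferred to y and perturb to x' >> x
   and y >> y'.  Were y' weakly preferred to x', then y' >= x' > x >= y would
   give y' >= y by Grodal transitivity, contradicting y > y'. *)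
Require Import Defs.
From mathcomp Require Import all_boot all_order all_algebra.
From mathcomp Require Import all_classical all_reals all_analysis.
Import numFieldNormedType.Exports.
Local Open Scope classical_set_scope.

Set Implicit Arguments.
Unset Strict Implicit.
Unset Printing Implicit Defensive.
Import Order.TTheory GRing.Theory Num.Theory.
Local Open Scope ring_scope.

(** * Extraction of subsequences *)

Lemma frequently_subseq (P : nat -> Prop) :
  (forall N, exists2 n, (N <= n)%N & P n) ->
  exists2 k : nat -> nat, {homo k : m n / (m < n)%N} & forall n, P (k n).
Proof.
move=> freqP; have /choice[nxt nxtP] N : exists n, (N < n)%N /\ P n.
  by have [n Nn Pn] := freqP N.+1; exists n.
exists (fun n => iter n nxt (nxt 0%N)).
  apply: homo_ltn => [|n]; first exact: ltn_trans.
  by have [] := nxtP (iter n nxt (nxt 0%N)).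
by case=> [|n]; [have [] := nxtP 0%N | have [] := nxtP (iter n nxt (nxt 0%N))].
Qed.

Lemma cvg_subseq (T : topologicalType) (v : nat -> T) (k : nat -> nat) (x : T) :
  {homo k : m n / (m < n)%N} -> v @ \oo --> x -> (v \o k) @ \oo --> x.
Proof.
move=> kh; apply: cvg_comp => P [N _ NP]; exists N => // n /= Nn; apply: NP.
apply: leq_trans Nn _; elim: n => // n ih.
by apply: leq_ltn_trans ih _; exact: kh.
Qed.

(** * Limits under closed convergence, and local strictness *)

Section relations.
Context {X : topologicalType}.
Implicit Types (x y z : X) (A : set (X * X)) (u : nat -> set (X * X)) (v : nat -> X * X).

Lemma cvg_unpair v x y : v @ \oo --> (x, y) ->
  ((v n).1 @[n --> \oo] --> x) /\ ((v n).2 @[n --> \oo] --> y).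
Proof.
move=> vxy; split.
  exact: (@cvg_comp _ _ _ v fst \oo _ (nbhs x) vxy cvg_fst).
exact: (@cvg_comp _ _ _ v snd \oo _ (nbhs y) vxy cvg_snd).
Qed.

(** The indices [n] with [u n (v n)] are unbounded, so they form a subsequence to which the second
    clause of closed convergence applies. Contrapositively, sequences tending to a pair outside [A]
    eventually leave [u n]. *)
Lemma closed_convergence_frequently u A v x y :
  closed_convergence u A -> v @ \oo --> (x, y) ->
  ~ (\forall n \near \oo, ~ u n (v n)) -> A (x, y).
Proof.
move=> [_ uA] vxy freq.
have [|k kh uk] := @frequently_subseq (fun n => u n (v n)).
  move=> N; apply: contrapT => none; apply: freq; exists N => // n /= Nn un.
  by apply: none; exists n.
exact: (uA k kh (v \o k)) (cvg_subseq kh vxy).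
Qed.

Lemma complete_not_strict A x y : complete_rel A -> ~ A (y, x) -> strict A x y.
Proof. by move=> cA nyx; split=> //; case: (cA x y). Qed.

(** If the constant sequences at [(x, y)] and [(y, x)] both eventually left [u n], some single [u n]
    would relate the two points in neither direction. *)
Lemma closed_convergence_complete u A :
  closed_convergence u A -> (forall n, complete_rel (u n)) -> complete_rel A.
Proof.
move=> uA uc x y.
have [ev|] := pselect (\forall n \near \oo, ~ u n (x, y)); last first.
  move=> fr; left.
  exact: (@closed_convergence_frequently u A (fun=> (x, y)) x y uA (@cvg_cst _ _ _ _ _)).
right.
apply: (@closed_convergence_frequently u A (fun=> (y, x)) y x uA (@cvg_cst _ _ _ _ _)).
move=> ev'; have [n [nxy nyx]] : exists n, ~ u n (x, y) /\ ~ u n (y, x).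
  by apply: (@filter_ex _ \oo); exact: filterI ev ev'.
by case: (uc n x y).
Qed.

Lemma closed_convergence_Grodal u A :
  closed_convergence u A -> (forall n, complete_rel (u n)) ->
  (forall n, Grodal_transitive (u n)) -> Grodal_transitive A.
Proof.
move=> uA uc ut x y z w /(proj1 uA)[v [vxy uv]] [_ nzy].
move=> /(proj1 uA)[v' [vzw uv']].
have [vx vy] := cvg_unpair vxy; have [vz vw] := cvg_unpair vzw.
(* Openness of strict preference, along the sequences approximating [z] and [y]; completeness of
   [u n] will turn this failure into strictness. *)
have ev : \forall n \near \oo, ~ u n ((v' n).1, (v n).2).
  apply: contrapT => fr; apply: nzy.
  exact: closed_convergence_frequently uA (cvg_pair vz vy) fr.
apply: (closed_convergence_frequently uA (cvg_pair vx vw)) => ev'.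
have [n [nzy' nxw]] := filter_ex (filterI ev ev').
apply: nxw; apply: (ut n _ (v n).2 (v' n).1 _).
- by rewrite -surjective_pairing.
- exact: complete_not_strict.
- by rewrite -surjective_pairing.
Qed.

Lemma closed_convergence_monotone (D : X -> X -> Prop) u A :
  open [set p | D p.1 p.2] -> closed_convergence u A ->
  (forall n, strictly_monotone D (u n)) -> strictly_monotone D A.
Proof.
move=> oD uA um x y Dxy; split.
  apply: (proj2 uA id _ (fun=> (x, y))) => //; last exact: cvg_cst.
  by move=> n; have [] := um n x y Dxy.
move=> /(proj1 uA)[v [vyx uv]].
have vxy : ((v n).2, (v n).1) @[n --> \oo] --> (x, y).
  by have [vy vx] := cvg_unpair vyx; exact: cvg_pair.
(* The swapped pairs eventually lie in the open relation [D], so [u N] is strict there, against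
   [u N (v N)]. *)
have /vxy[N _ /(_ N (leqnn N))] : nbhs (x, y) [set p | D p.1 p.2].
  exact: open_nbhs_nbhs.
by move=> /(um N)[_]; rewrite -surjective_pairing.
Qed.

Lemma monotone_locally_strict (D : X -> X -> Prop) A :
  (forall x, closure [set x' | D x' x] x) ->
  (forall y, closure [set y' | D y y'] y) ->
  complete_rel A -> Grodal_transitive A -> strictly_monotone D A ->
  locally_strict A.
Proof.
move=> clu cll cA tA mA x y Axy V [[V1 V2] /= [V1x V2y] V12].
have [x' [Dx' V1x']] := clu x V1 V1x.
have [y' [Dy' V2y']] := cll y V2 V2y.
exists x', y'; split; first exact: V12.
apply: complete_not_strict => // Ayx'.
have [_] := mA _ _ Dy'; apply.
exact: tA Ayx' (mA _ _ Dx') Axy.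
Qed.

End relations.

(** * Transport of topological properties along a homeomorphism *)

Section homeomorphism.
Context {X Y : topologicalType} (f : X -> Y) (g : Y -> X).
Hypotheses (fK : cancel f g) (gK : cancel g f).
Hypotheses (cf : continuous f) (cg : continuous g).

Lemma homeomorphism_locally_compact :
  locally_compact [set: Y] -> locally_compact [set: X].
Proof.
move=> lcY x _; rewrite withinET.
have := lcY (f x) I; rewrite withinET => -[K nK [cK clK]].
(* Continuous images, unlike preimages, preserve compactness. *)
have fKE : f @^-1` K = g @` K.
  by rewrite eqEsubset; split=> [z Kz|_ [z Kz <-]/=]; rewrite ?gK//; exists (f z).
exists (f @^-1` K); first exact: cf nK.
split; last by apply: preimage_closed => // z _; exact: cf.
by rewrite fKE; apply: continuous_compact => //; exact: continuous_subspaceT.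
Qed.

Lemma homeomorphism_separable : separable Y -> separable X.
Proof.
move=> [S cS dS]; exists (g @` S).
  exact: card_le_trans (card_image_le _ _) cS.
move=> O [x Ox] oO.
have [||y [Oy Sy]] := dS (g @^-1` O).
- by exists (f x); rewrite /= fK.
- by apply: open_comp => // z _; exact: cg.
by exists (g y); split=> //; exists y.
Qed.

(** The metric is pulled back along [f]; the limit of the image of a Cauchy sequence is sent back by
    [g]. *)
Lemma homeomorphism_completely_metrizable (R : realType) :
  completely_metrizable R Y -> completely_metrizable R X.
Proof.
move=> [e [e0 eC eT eN eB]]; exists (fun x y => e (f x) (f y)); split.
- by move=> x y; rewrite e0; split=> [/(can_inj fK)|->].
- by move=> x y; exact: eC.
- by move=> x y z; exact: eT.
- move=> x V; split=> [nV|[r r0 rV]].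
    have /eN[r r0 rV] : nbhs (f x) (g @^-1` V) by apply: cg; rewrite fK.
    by exists r => // y /= /rV /=; rewrite fK.
  have /cf nf : nbhs (f x) [set y | e (f x) y < r] by apply/eN; exists r.
  exact: filterS rV nf.
- move=> u /eB[y uy]; exists (g y).
  have -> : u = g \o (f \o u) by apply/funext => n /=; rewrite fK.
  by apply: cvg_comp uy _; exact: cg.
Qed.

End homeomorphism.

(** * Topology of the space of row vectors *)

Lemma rV_completely_metrizable (R : realType) n :
  completely_metrizable R 'rV[R]_n.
Proof.
exists (fun x y => `|x - y|); split.
- move=> x y; split=> [/eqP|->]; last by rewrite subrr normr0.
  by rewrite normr_eq0 subr_eq0 => /eqP.
- by move=> x y; rewrite distrC.
- by move=> x y z; exact: ler_distD.
- move=> x P; exact: (@nbhs_normP R 'rV[R]_n).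
- move=> u uC; suff : cvg (u @ \oo) by move=> ?; exists (lim (u @ \oo)).
  apply/cauchy_cvgP/cauchy_exP => e /uC[N uN]; exists (u N).
  by exists N => // m /= Nm; rewrite -ball_normE; exact: uN.
Qed.

Lemma rV_locally_compact (R : realType) n : locally_compact [set: 'rV[R]_n].
Proof.
move=> x _; rewrite withinET; exists (closed_ball x 1).
  by apply/nbhs_closedballP; exists 1%:pos.
split; last exact: closed_ball_closed.
apply: bounded_closed_compact; last exact: closed_ball_closed.
(* The bound comes from writing [y] as [x - (x - y)] with [x - y] of norm at most 1. *)
rewrite closed_ballE// /bounded_set; exists (`|x| + 1); split => //.
move=> M xM y; rewrite /closed_ball_ /= => xy; apply: le_trans (ltW xM).
by rewrite -[y](subKr x) (le_trans (ler_normB _ _))// lerD2l.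
Qed.

Lemma rV_separable (R : realType) n : separable 'rV[R]_n.
Proof.
exists (range (map_mx ratr : 'rV[rat]_n -> 'rV[R]_n)).
  exact: card_le_trans (card_image_le _ _) (countableP _).
(* [O] contains a box around [x] with sides [P], so a rational point can be chosen coordinate by
   coordinate. *)
move=> O [x Ox]; rewrite openE => /(_ _ Ox)[P nP PO].
have /choice[q qP] j : exists q, P ord0 j (ratr q).
  have [||r [Pr [q _ qr]]] := @dense_rat R (P ord0 j)°.
  - by exists (x ord0 j); exact: nP.
  - exact: open_interior.
  by exists q; rewrite qr; exact: interior_subset Pr.
exists (map_mx ratr (\row_j q j)); split; last by exists (\row_j q j).
by apply: PO => i j; rewrite !mxE (ord1 i).
Qed.

(** * The positive orthant: logarithmic coordinates and the relation [all_gt] *)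

Section positive_orthant.
Context {R : realType} {d : nat}.
Implicit Types x y : posR R d.

Lemma posR_gt0 x i : 0 < \val x ord0 i.
Proof. by have /set_mem := valP x; exact. Qed.

Definition ln_coords x : 'rV[R]_d := map_mx (@ln R) (\val x).

Lemma expR_coords_positive (v : 'rV[R]_d) :
  map_mx (@expR R) v \in positive_vectors R d.
Proof. by apply/mem_set => i; rewrite mxE expR_gt0. Qed.

Definition expR_coords (v : 'rV[R]_d) : posR R d :=
  exist _ (map_mx (@expR R) v) (expR_coords_positive v).

Lemma ln_coordsK : cancel ln_coords expR_coords.
Proof.
move=> x; apply: val_inj; apply/rowP => i.
by rewrite !mxE lnK// posrE posR_gt0.
Qed.

Lemma expR_coordsK : cancel expR_coords ln_coords.
Proof. by move=> v; apply/rowP => i; rewrite !mxE expRK. Qed.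

Lemma posR_coord_continuous i : continuous (fun x => \val x ord0 i).
Proof.
move=> x; apply: (@continuous_comp _ _ _ (\val : posR R d -> 'rV[R]_d)
  (fun v => v ord0 i)); first exact: initial_continuous.
exact: coord_continuous.
Qed.

Lemma rV_continuous (T : topologicalType) (f : T -> 'rV[R]_d) :
  (forall i, continuous (fun t => f t ord0 i)) -> continuous f.
Proof.
move=> cf t U [P nP PU].
(* There are finitely many coordinates, so the neighborhoods of [t] obtained for each may be
   intersected. *)
have : \forall s \near t, forall j, P ord0 j (f s ord0 j).
  by apply: filter_forall => j; exact: cf (nP _ _).
by apply: filterS => s sP; apply: PU => i j; rewrite (ord1 i).
Qed.

Lemma ln_coords_continuous : continuous ln_coords.
Proof.
apply: rV_continuous => i x; under eq_fun do rewrite mxE.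
apply: (@continuous_comp _ _ _ (fun x => \val x ord0 i) (@ln R)).
  exact: posR_coord_continuous.
exact/continuous_ln/posR_gt0.
Qed.

Lemma expR_coords_continuous : continuous expR_coords.
Proof.
(* The orthant carries the initial topology of [\val], so continuity is checked after composing with
   [\val]. *)
apply: continuous_comp_initial; apply: rV_continuous => i v.
under eq_fun do rewrite /= mxE.
apply: (@continuous_comp _ _ _ (fun v : 'rV[R]_d => v ord0 i) (@expR R)).
  exact: coord_continuous.
exact: continuous_expR.
Qed.

(** A finite intersection, over the coordinates, of preimages of the open half-line under continuous
    differences. *)
Lemma open_all_gt : open [set p : posR R d * posR R d | all_gt p.1 p.2].
Proof.
rewrite openE => p pgt.
pose gt i := [set q : posR R d * posR R d | \val q.2 ord0 i < \val q.1 ord0 i].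
apply: (@filter_forall _ _ gt (nbhs p)) => i; rewrite /gt.
have : open_nbhs p [set q : posR R d * posR R d |
    0 < \val q.1 ord0 i - \val q.2 ord0 i].
  split; last by rewrite /= subr_gt0; exact: pgt.
  apply: (@open_comp _ _
    (fun q : posR R d * posR R d => \val q.1 ord0 i - \val q.2 ord0 i)
    [set r | 0 < r]); last exact: open_gt.
  move=> q _; apply: (@continuousB _ R^o).
    apply: (@continuous_comp _ _ _ fst (fun x => \val x ord0 i)).
      exact: cvg_fst.
    exact: posR_coord_continuous.
  apply: (@continuous_comp _ _ _ snd (fun x => \val x ord0 i)).
    exact: cvg_snd.
  exact: posR_coord_continuous.
by move=> /open_nbhs_nbhs; apply: filterS => q /=; rewrite subr_gt0.
Qed.

(** This is the vector [x] multiplied by the scalar [expR t]; as a translation in logarithmic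
    coordinates it stays in the orthant for every real [t]. *)
Definition scale_expR x (t : R) := expR_coords (ln_coords x + const_mx t).

Lemma all_gt_scale_expR x s t :
  s < t -> all_gt (scale_expR x t) (scale_expR x s).
Proof. by move=> st i; rewrite !mxE ltr_expR ltrD2l. Qed.

Lemma scale_expR0 x : scale_expR x 0 = x.
Proof. by rewrite /scale_expR (_ : const_mx 0 = 0)// addr0 ln_coordsK. Qed.

Lemma scale_expR_continuous x : continuous (scale_expR x).
Proof.
move=> t; apply: (@continuous_comp _ _ _ (fun t => ln_coords x + const_mx t)
  expR_coords); last exact: expR_coords_continuous.
apply: rV_continuous => i s; under eq_fun do rewrite !mxE.
by apply: cvgD; [exact: cvg_cst|exact: cvg_id].
Qed.

(** The multiples of [x] by [expR t] with [t > 0] dominate [x] and tend to it as [t] decreases to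
    0. *)
Lemma closure_all_gt_above x : closure [set y | all_gt y x] x.
Proof.
move=> V Vx.
have V0 : \forall t \near (0 : R)^'+, V (scale_expR x t).
  by apply/cvg_within/scale_expR_continuous; rewrite scale_expR0.
have [t [Vt t0]] := @filter_ex _ (0 : R)^'+ _ _
  (@filterI _ _ _ _ _ V0 (nbhs_right_gt 0)).
exists (scale_expR x t); split=> //=.
by rewrite -[X in all_gt _ X]scale_expR0; exact: all_gt_scale_expR.
Qed.

Lemma closure_all_gt_below x : closure [set y | all_gt x y] x.
Proof.
move=> V Vx.
(* Negative [t] shrinks [x] without leaving the orthant. *)
have V0 : \forall t \near (0 : R)^'-, V (scale_expR x t).
  by apply/cvg_within/scale_expR_continuous; rewrite scale_expR0.
have [t [Vt t0]] := @filter_ex _ (0 : R)^'- _ _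
  (@filterI _ _ _ _ _ V0 (nbhs_left_lt 0)).
exists (scale_expR x t); split=> //=.
by rewrite -[X in all_gt X _]scale_expR0; exact: all_gt_scale_expR.
Qed.

Lemma Grodal_monotone_preferences_closed :
  closed (Grodal_monotone_preferences R d).
Proof.
apply/closed_continuous_relP => u A uA uP.
have uc n : complete_rel (u n) by have [[]] := uP n.
split.
(* Closedness of the limit is carried by the type [continuous_rel]. *)
- by split; [exact: closed_convergence_complete uA uc | exact: graph_closed].
- by apply: closed_convergence_Grodal uA uc _ => n; have [] := uP n.
- by apply: closed_convergence_monotone open_all_gt uA _ => n; have [] := uP n.
Qed.

End positive_orthant.

Theorem corollary5 (R : realType) (d : nat) (hd : (2 <= d)%N) :
  [/\ locally_compact [set: posR R d],
      separable (posR R d) &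
      completely_metrizable R (posR R d)] /\
  closed (Grodal_monotone_preferences R d) /\
  (forall A : continuous_rel (posR R d),
     Grodal_monotone_preferences R d A -> locally_strict A).
Proof.
have [lnK expK] := (@ln_coordsK R d, @expR_coordsK R d).
have [cln cexp] := (@ln_coords_continuous R d, @expR_coords_continuous R d).
split; last split.
- split.
  + apply: homeomorphism_locally_compact lnK expK cln cexp _.
    exact: rV_locally_compact.
  + exact: homeomorphism_separable lnK cexp (rV_separable _ _).
  + apply: (homeomorphism_completely_metrizable lnK cln cexp).
    exact: rV_completely_metrizable.
- exact: Grodal_monotone_preferences_closed.
- move=> A [[cA _] tA mA].
  exact: monotone_locally_strict closure_all_gt_above closure_all_gt_below
    cA tA mA.
Qed.
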